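(* Let $\theta\in[0,1]$, let $(p_x,q_x)_{x\in\mathbb Z}$ be uniformly bounded nonnegative jump rates, and let $(\eta_t)_{t\ge0}$ be the mixed coalescing/annihilating nearest-neighbour particle system on $\mathbb Z$ described in the context. For any deterministic initial condition $\eta\in\{0,1\}^{\mathbb Z}$ and at any fixed time $t\ge0$, under $\mathbf P_\eta$ the configuration $\eta_t$ is a Pfaffian point process on $\mathbb Z$ whose kernel $\mathbf K:\mathbb Z^2\to\mathbb R^{2\times2}$ is given, for $y<z$, by \[ \mathbf K(y,z)=\frac{1}{1+\theta}\begin{pmatrix} K_t(y,z) & -D^+_2K_t(y,z)\\ -D^+_1K_t(y,z) & D^+_1D^+_2K_t(y,z)\end{pmatrix}, \] by $\mathbf K_{12}(y,y)=\frac{-1}{1+\theta}D^+_2K_t(y,y)$, and with all other entries determined by the symmetry relations $\mathbf K_{ij}(y,z)=-\mathbf K_{ji}(z,y)$, $i,j\in\{1,2\}$, $y,z\in\mathbb Z$. Here $K_t(y,z)=\mathbf E_\eta[\sigma_{y,z}(\eta_t)]$ for $y\le z$.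
   Context: The process: between interactions, particles perform independent nearest-neighbour random walks, a particle jumping $x\to x-1$ at rate $q_x$ and $x-1\to x$ at rate $p_x$; when a particle jumps onto an occupied site, with probability $\theta$ both particles disappear (annihilation) and with probability $1-\theta$ one particle remains (coalescence). Formally $\eta_t\in\{0,1\}^{\mathbb Z}$ ($\eta_t(x)=1$ means a particle at $x$) is the Markov process with generator, for $F$ depending on finitely many coordinates, $\mathcal L F(\eta)=\sum_{x}q_x\big(\theta F(\eta^a_{x,x-1})+(1-\theta)F(\eta^c_{x,x-1})-F(\eta)\big)+\sum_x p_x\big(\theta F(\eta^a_{x-1,x})+(1-\theta)F(\eta^c_{x-1,x})-F(\eta)\big)$, where for $x\neq y$ the configurations $\eta^a_{x,y},\eta^c_{x,y}$ agree with $\eta$ off $\{x,y\}$, vanish at $x$, and $\eta^a_{x,y}(y)=(\eta(x)+\eta(y))\bmod 2$, $\eta^c_{x,y}(y)=\min\{1,\eta(x)+\eta(y)\}$. $\mathbf P_\eta,\mathbf E_\eta$ denote law and expectation started from $\eta$. Notation: for $y<z$, $\eta[y,z)=\sum_{y\le x<z}\eta(x)$, and $\eta[y,y)=0$; $\sigma_{y,z}(\eta)=(-\theta)^{\eta[y,z)}$ with the convention $0^0=1$. $D^+f(x)=f(x+1)-f(x)$, and $D^+_i$ means $D^+$ applied in the $i$th variable. Pfaffian: for an antisymmetric $2n\times2n$ matrix $A$, $\mathrm{Pf}(A)=\frac{1}{2^nn!}\sum_{\pi\in S_{2n}}\mathrm{sgn}(\pi)\prod_{i=1}^n a_{\pi(2i-1)\pi(2i)}$.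 A random $\eta\in\{0,1\}^{\mathbb Z}$ is a Pfaffian point process with kernel $\mathbf K:\mathbb Z^2\to\mathbb R^{2\times2}$ (satisfying $\mathbf K_{ij}(y,z)=-\mathbf K_{ji}(z,y)$) if for every $n\ge1$ and distinct $x_1,\dots,x_n$, $\mathbf E[\eta(x_1)\cdots\eta(x_n)]=\mathrm{Pf}(\mathbf K(x_i,x_j))_{i,j\le n}$, where the $2n\times2n$ antisymmetric matrix is built from the $2\times2$ blocks $\mathbf K(x_i,x_j)$. *)

(* Defs.v *)
From HB Require Import structures.
From mathcomp Require Import all_boot all_order all_algebra.
From mathcomp Require Import all_fingroup zify.
From mathcomp Require Import all_classical all_reals all_analysis.
Set Implicit Arguments. Unset Strict Implicit. Unset Printing Implicit Defensive.
Import Order.TTheory GRing.Theory Num.Theory.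
Import numFieldNormedType.Exports.
Local Open Scope ring_scope.

(* Configurations: eta : int -> bool  (eta x = true means a particle at x). *)
Definition config := int -> bool.

Section Defs.
Variable R : realType.

Definition upd_a (x y : int) (eta : config) : config :=
  fun z => if z == y then addb (eta x) (eta y) else if z == x then false else eta z.
Definition upd_c (x y : int) (eta : config) : config :=
  fun z => if z == y then (eta x || eta y) else if z == x then false else eta z.

Definition depends_within (N : nat) (F : config -> R) : Prop :=
  forall e1 e2 : config, (forall x : int, - (N%:Z) <= x <= N%:Z -> e1 x = e2 x) ->
    F e1 = F e2.

Definition cylinder (F : config -> R) : Prop := exists N, depends_within N F.

(* The generator L applied to F; for F depending only on [-N, N] only the
   terms x in [-N, N+1] are nonzero, so this is exactly L F for such F. *)
Definition gen (theta : R) (p q : int -> R) (N : nat) (F : config -> R)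
  (eta : config) : R :=
  \sum_(k < (N.*2).+2)
    let x : int := k%:Z - N%:Z in
      q x * (theta * F (upd_a x (x - 1) eta) + (1 - theta) * F (upd_c x (x - 1) eta)
             - F eta)
    + p x * (theta * F (upd_a (x - 1) x eta) + (1 - theta) * F (upd_c (x - 1) x eta)
             - F eta).

Definition cnt (eta : config) (y z : int) : nat :=
  (\sum_(0 <= k < `|Num.max (0:int) (z - y)%R|%N) (eta (y + k%:Z)%R : nat))%N.

(* sigma_{y,z}(eta) = (-theta)^{eta[y,z)}, with 0^0 = 1 *)
Definition sigma (theta : R) (y z : int) (eta : config) : R :=
  (- theta) ^+ cnt eta y z.

(* Upper-triangular block (y < z), without the factor 1/(1+theta);
   index false = 1st row/column, true = 2nd. *)
Definition Kup (K : int -> int -> R) (y z : int) (a b : bool) : R :=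
  match a, b with
  | false, false => K y z
  | false, true => - (K y (z + 1) - K y z)
  | true, false => - (K (y + 1) z - K y z)
  | true, true => K (y + 1) (z + 1) - K (y + 1) z - K y (z + 1) + K y z
  end.

(* The 2x2 kernel bold K(y, z)_{ab} built from K, using the antisymmetry
   K_ij(y,z) = - K_ji(z,y) for y > z and for the diagonal blocks. *)
Definition Kbold (theta : R) (K : int -> int -> R) (y z : int) (a b : bool) : R :=
  let c := (1 + theta)^-1 in
  if y < z then c * Kup K y z a b
  else if y == z then
    (match a, b with
     | false, true => - c * (K y (y + 1) - K y y)
     | true, false => c * (K y (y + 1) - K y y)
     | _, _ => 0
     end)
  else - (c * Kup K z y b a).

Lemma idx2_proof (n : nat) (i : 'I_n) (b : bool) : (i.*2 + b < n.*2)%N.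
Proof.
have := ltn_ord i; rewrite -!muln2; case: b => /=; lia.
Qed.

Definition idx2 (n : nat) (i : 'I_n) (b : bool) : 'I_(n.*2) :=
  Ordinal (idx2_proof i b).

Definition pfaffian (n : nat) (A : 'I_(n.*2) -> 'I_(n.*2) -> R) : R :=
  ((2 ^ n * n`!)%:R)^-1 *
  \sum_(s : 'S_(n.*2)) (-1) ^+ s * \prod_(i < n) A (s (idx2 i false)) (s (idx2 i true)).

(* The 2n x 2n matrix built from the 2x2 blocks Kb(x_i, x_j); row index
   2i + a corresponds to (point x_i, block row a). *)
Definition block_matrix (n : nat) (Kb : int -> int -> bool -> bool -> R)
  (x : nat -> int) : 'I_(n.*2) -> 'I_(n.*2) -> R :=
  fun u v => Kb (x (u./2)) (x (v./2)) (odd u) (odd v).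

End Defs.

(* Main.v *)
Require Import Defs.
From HB Require Import structures.
From mathcomp Require Import all_boot all_order all_algebra.
From mathcomp Require Import all_fingroup ring lra zify.
From mathcomp Require Import all_classical all_reals all_analysis.
Import Order.TTheory GRing.Theory Num.Theory.
Import numFieldNormedType.Exports.
Local Open Scope classical_set_scope.
Local Open Scope ring_scope.
Set Implicit Arguments.
Unset Strict Implicit.
Unset Printing Implicit Defensive.

(* For y_1 <= ... <= y_2m, the functions E_t[prod_i sigma_{y_(2i-1), y_(2i)}]
   and Pf(K_t(y_i, y_j)) solve the same linear system of differential
   equations: on strictly increasing y the particle generator acts on the
   product of spins as the generator of independent walks of the endpoints y_i
   (this is where the powers of -theta are needed), and the Pfaffian inherits
   the equation from its entries by the Leibniz rule. When y_i = y_(i+1) both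
   functions reduce to the one with the pair removed, at t = 0 the Pfaffian of
   the multiplicative kernel sigma is the product, and both are bounded; since
   the rates are bounded, iterating the integrated equation as in Picard's
   theorem shows that they agree. As sigma_{x,x} - sigma_{x,x+1} =
   (1 + theta) eta(x), differences in the even-indexed y give the correlation
   functions, and by multilinearity these differences act on the entries of the
   Pfaffian. *)

(** * Pfaffians indexed by lists *)

Section ListPfaffian.
Variable R : comNzRingType.

Section Contraction.
Variable T : eqType.
Implicit Types (f : T -> R) (g : seq T -> R) (s : seq T).

(** The interior product of g with f, that is the sum of (-1)^j f(s_j) g(s without s_j); the terms
    that keep the head push it into the argument of g. *)
Fixpoint contr f g s : R :=
  if s is x :: s' then f x * g s' - contr f (fun l => g (x :: l)) s' else 0.

Lemma eq_contr f f' g g' s :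
  {in s, f =1 f'} -> (forall l, subseq l s -> g l = g' l) ->
  contr f g s = contr f' g' s.
Proof.
elim: s g g' => // x s IHs g g' eqf eqg.
rewrite /= eqf ?mem_head // eqg ?subseq_cons //; congr (_ - _).
apply: IHs => [y ys|l ls]; first by rewrite eqf // inE ys orbT.
by rewrite eqg //= eqxx.
Qed.

Lemma contrDl f f' g s : contr (fun x => f x + f' x) g s = contr f g s + contr f' g s.
Proof. by elim: s g => [|x s IHs] g /=; [rewrite addr0|rewrite IHs; ring]. Qed.

Lemma contrZl a f g s : contr (fun x => a * f x) g s = a * contr f g s.
Proof. by elim: s g => [|x s IHs] g /=; [rewrite mulr0|rewrite IHs; ring]. Qed.

Lemma contrDr f g g' s : contr f (fun l => g l + g' l) s = contr f g s + contr f g' s.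
Proof. by elim: s g g' => [|x s IHs] g g' /=; [rewrite addr0|rewrite IHs; ring]. Qed.

Lemma contrZr a f g s : contr f (fun l => a * g l) s = a * contr f g s.
Proof. by elim: s g => [|x s IHs] g /=; [rewrite mulr0|rewrite IHs; ring]. Qed.

Lemma contrBl f f' g s : contr (fun x => f x - f' x) g s = contr f g s - contr f' g s.
Proof. by elim: s g => [|x s IHs] g /=; [rewrite subr0|rewrite IHs; ring]. Qed.

Lemma contrBr f g g' s : contr f (fun l => g l - g' l) s = contr f g s - contr f g' s.
Proof. by elim: s g g' => [|x s IHs] g g' /=; [rewrite subr0|rewrite IHs; ring]. Qed.

Lemma contr0r f s : contr f (fun=> 0) s = 0.
Proof. by elim: s => //= x s ->; rewrite mulr0 subr0. Qed.

(** Two given entries can be removed in either order, with opposite signs. *)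
Lemma contr_contr f g s : contr f (contr f g) s = 0.
Proof.
elim: s g => //= x s IHs g.
by rewrite contrBr contrZr IHs subr0 subrr.
Qed.

(** Removing either copy of y leaves the same list, with opposite signs, so these two terms cancel;
    in all other terms both copies survive inside g. *)
Lemma contr_cat_pair f g h y s1 s2 :
  (forall l1 l2, g (l1 ++ [:: y, y & l2]) = h (l1 ++ l2)) ->
  contr f g (s1 ++ [:: y, y & s2]) = contr f h (s1 ++ s2).
Proof.
elim: s1 g h => [|x s1 IHs] g h gh /=.
  rewrite opprB addrC subrK; apply: eq_contr => // l _.
  exact: (gh [::]).
rewrite gh (IHs _ (fun l => h (x :: l))) // => l1 l2.
exact: (gh (x :: l1)).
Qed.

(* Expansion along the first row of the Pfaffian of order 2n indexed by the
   points of s (zero unless size s = 2n); only the entries K x y with x listed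
   before y are read. *)
Fixpoint pfl (K : T -> T -> R) (n : nat) (s : seq T) : R :=
  if n is n'.+1 then
    if s is x :: s' then contr (K x) (pfl K n') s' else 0
  else (size s == 0%N)%:R.

Lemma eq_pfl K K' n s : pairwise (fun x y => K x y == K' x y) s ->
  pfl K n s = pfl K' n s.
Proof.
elim: n s => // n IHn [|x s] //= /andP[/allP Kx Ks].
apply: eq_contr => [y ys|l ls]; first exact/eqP/Kx.
exact/IHn/(subseq_pairwise ls).
Qed.

Lemma pflZ c K n s : pfl (fun x y => c * K x y) n s = c ^+ n * pfl K n s.
Proof.
elim: n s => [|n IHn] [|x s] /=; rewrite ?expr0 ?mul1r ?mulr0 //.
rewrite contrZl exprS -mulrA; congr (_ * _).
by rewrite -contrZr; apply: eq_contr.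
Qed.

(* K(x,z) = K(x,y) K(y,z) makes the contributions of x and y to the
   remaining points proportional, so they cancel by antisymmetry. *)
Lemma pfl_mul_cons K n x y s : {in s, forall z, K x z = K x y * K y z} ->
  pfl K n.+1 [:: x, y & s] = K x y * pfl K n s.
Proof.
move=> Kxy /=.
rewrite (@eq_contr (K x) (fun z => K x y * K y z) _ (fun l => pfl K n (y :: l)))//.
rewrite contrZl; case: n => [|n] /=; last by rewrite contr_contr mulr0 subr0.
by rewrite contr0r mulr0 subr0.
Qed.

(** A pair at the head is [pfl_mul_cons] with K y y = 1; further in, the pair survives the expansion
    along the head by [contr_cat_pair]. *)
Lemma pfl_cat_pair K n y s1 s2 : (forall z, K z z = 1) ->
  pfl K n.+1 (s1 ++ [:: y, y & s2]) = pfl K n (s1 ++ s2).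
Proof.
move=> K1; elim: n s1 s2 => [|n IHn] [|x s1] s2.
- by rewrite cat0s pfl_mul_cons ?K1 ?mul1r // => z; rewrite mul1r.
- rewrite /= (@contr_cat_pair _ _ (fun=> 0)) ?contr0r // => l1 l2.
  by rewrite size_cat /= addnS.
- by rewrite cat0s pfl_mul_cons ?K1 ?mul1r // => z; rewrite mul1r.
- by rewrite !cat_cons /= -/pfl; apply: contr_cat_pair => l1 l2; exact: IHn.
Qed.

(** Leibniz rule: the derivative of [pfl] at K in the direction K'. *)
Fixpoint dpfl (K K' : T -> T -> R) (n : nat) (s : seq T) : R :=
  if n is n'.+1 then
    if s is x :: s' then
      contr (K' x) (pfl K n') s' + contr (K x) (dpfl K K' n') s'
    else 0
  else 0.

Lemma contr_sum x0 f g s : contr f g s =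
  \sum_(j < size s) (-1) ^+ j * f (nth x0 s j) * g (take j s ++ drop j.+1 s).
Proof.
elim: s g => [|x s IHs] g /=; first by rewrite big_ord0.
rewrite big_ord_recl /= expr0 mul1r drop0 IHs -sumrN; congr (_ + _).
by apply: eq_bigr => i _; rewrite /bump /= add1n /= exprS; ring.
Qed.

End Contraction.

(** * Independent walks of the list entries *)

Section ListGenerator.
Variables p q : int -> R.

(** Duality reverses the jumps: an endpoint at x separates the sites x - 1 and x, and a particle
    jump from x to x - 1, at rate q_x, acts on spins in mean as a move of the endpoint to x + 1. *)
Definition site_gen (f : int -> R) (x : int) : R :=
  q x * (f (x + 1) - f x) + p x * (f (x - 1) - f x).

Fixpoint lgen (F : seq int -> R) (s : seq int) : R :=
  if s is x :: s' then
    site_gen (fun y => F (y :: s')) x + lgen (fun l => F (x :: l)) s'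
  else 0.

Lemma lgenB F G s : lgen (fun l => F l - G l) s = lgen F s - lgen G s.
Proof.
elim: s F G => [|x s IHs] F G /=; first by rewrite subr0.
by rewrite IHs /site_gen; ring.
Qed.

Lemma lgenZ a F s : lgen (fun l => a * F l) s = a * lgen F s.
Proof.
elim: s F => [|x s IHs] F /=; first by rewrite mulr0.
by rewrite IHs /site_gen; ring.
Qed.

(** Each term reads one entry through f and the others through g, so moving one entry changes
    exactly one factor. *)
Lemma lgen_contr f g s :
  lgen (contr f g) s = contr (site_gen f) g s + contr f (lgen g) s.
Proof.
elim: s g => [|x s IHs] g /=; first by rewrite addr0.
rewrite lgenB lgenZ IHs contrDr /site_gen contrDr !contrZr !contrBr; ring.
Qed.

(** Each entry occurs in one factor of every product of the Pfaffian; sortedness confines the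
    equation for K' to x < y. *)
Lemma dpfl_lgen K K' n s : sorted <%R s ->
  (forall x y, x < y -> K' x y = site_gen (K^~ y) x + site_gen (K x) y) ->
  dpfl K K' n s = lgen (pfl K n) s.
Proof.
move=> + K'E; elim: n s => [|n IHn] [|x s] //=.
  have lg0 l : lgen (fun=> 0) l = 0.
    by elim: l => //= a l ->; rewrite /site_gen subrr !mulr0 !addr0.
  by move=> _; rewrite lg0 /site_gen subrr !mulr0 !addr0.
move=> xs; have ss := path_sorted xs.
rewrite lgen_contr addrA.
congr (_ + _); last first.
  apply: eq_contr => // l ls; apply: IHn.
  exact: (subseq_sorted lt_trans ls ss).
rewrite /site_gen -!contrBl -!contrZl -!contrDl.
apply: eq_contr => // y ys; rewrite K'E ?/site_gen//.
by move: xs => /(order_path_min lt_trans)/allP/(_ _ ys).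
Qed.

End ListGenerator.

(** * Differences in selected entries *)

Section Difference.

(** The sign is that of sigma_{x,x} - sigma_{x,x+1}, and it produces the minus signs in the
    off-diagonal kernel entries. *)
Definition diff_at (a : bool) (f : int -> R) (y : int) : R :=
  if a then f y - f (y + 1) else f y.

Fixpoint ldiff (F : seq int -> R) (s : seq (int * bool)) : R :=
  if s is (y, a) :: s' then
    diff_at a (fun z => ldiff (fun l => F (z :: l)) s') y
  else F [::].

Lemma ldiffB F G s : ldiff (fun l => F l - G l) s = ldiff F s - ldiff G s.
Proof.
by elim: s F G => [|[y []] s IHs] F G //=; rewrite !IHs /diff_at //; ring.
Qed.

Lemma ldiffZ c F s : ldiff (fun l => c * F l) s = c * ldiff F s.
Proof.
by elim: s F => [|[y []] s IHs] F //=; rewrite !IHs /diff_at //; ring.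
Qed.

Lemma ldiff_contr f g s :
  ldiff (contr f g) s = contr (fun u => diff_at u.2 f u.1) (ldiff g) s.
Proof.
elim: s g => [|[y a] s IHs] g //=.
by case: a; rewrite /diff_at !(ldiffB, ldiffZ) !IHs ?contrBr; ring.
Qed.

Definition diff_kernel (K : int -> int -> R) (u v : int * bool) : R :=
  diff_at u.2 (fun y => diff_at v.2 (K y) v.1) u.1.

(** Every variable enters each product of the Pfaffian through a single entry of K, so the
    differences pass to K. *)
Lemma ldiff_pfl K n s : ldiff (pfl K n) s = pfl (diff_kernel K) n s.
Proof.
elim: n s => [|n IHn] s.
  case: s => [|[y []] s] //=; rewrite /diff_at.
    by rewrite subrr.
  by elim: s => [|[z []] s IHs] //=; rewrite /diff_at ?IHs ?subrr.
case: s => [|[y a] s] //=.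
rewrite (_ : diff_kernel K (y, a) = fun v => diff_at a (fun y => diff_at v.2 (K y) v.1) y) //.
by case: a; rewrite /diff_at /= ?contrBl !ldiff_contr; do ?[congr (_ - _)];
   apply: eq_contr => // l _; rewrite IHn.
Qed.

(** The hypothesis covers just the lists that the differences evaluate, since the Pfaffian formula
    is available on weakly increasing lists only. *)
Lemma eq_ldiff F G s :
  (forall l, all2 (fun (z : int) (u : int * bool) =>
     (z == u.1) || u.2 && (z == u.1 + 1)) l s -> F l = G l) ->
  ldiff F s = ldiff G s.
Proof.
elim: s F G => [|[y a] s IHs] F G FG /=; first exact: FG.
case: a FG => FG; rewrite /diff_at; do ?[congr (_ - _)];
  by apply: IHs => l ls; apply: FG; rewrite /= eqxx ?orbT.
Qed.

End Difference.
End ListPfaffian.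

(** * Comparison with the permutation formula *)

Section BlockPermutations.
Variable n : nat.
Implicit Types (i j : 'I_n) (b : bool) (u : 'I_(n.*2)) (s t : 'S_n).

Lemma half_ord_proof u : (u./2 < n)%N.
Proof. by rewrite ltn_half_double. Qed.

Definition half_ord u : 'I_n := Ordinal (half_ord_proof u).

Lemma half_idx2 i b : half_ord (idx2 i b) = i.
Proof. by apply: val_inj; rewrite /= addnC half_bit_double. Qed.

Lemma odd_idx2 i b : odd (idx2 i b) = b.
Proof. by rewrite /= oddD odd_double; case: b. Qed.

Lemma idx2_half u : idx2 (half_ord u) (odd u) = u.
Proof. by apply: val_inj; rewrite /= addnC odd_double_half. Qed.

Lemma eq_idx2 i j a b : (idx2 i a == idx2 j b) = (i == j) && (a == b).
Proof.
apply/eqP/andP => [e|[/eqP-> /eqP->]//].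
by rewrite -(half_idx2 i a) -[X in _ /\ X == _](odd_idx2 i a) e half_idx2 odd_idx2.
Qed.

Definition block_fun s u : 'I_(n.*2) := idx2 (s (half_ord u)) (odd u).

Lemma block_fun_inj s : injective (block_fun s).
Proof.
move=> u v /eqP; rewrite eq_idx2 => /andP[/eqP/perm_inj uv /eqP ouv].
by rewrite -(idx2_half u) uv ouv idx2_half.
Qed.

Definition block_perm s : 'S_(n.*2) := perm (@block_fun_inj s).

Lemma block_permE s i b : block_perm s (idx2 i b) = idx2 (s i) b.
Proof. by rewrite permE /block_fun half_idx2 odd_idx2. Qed.

Lemma block_permM s t : block_perm (s * t) = (block_perm s * block_perm t)%g.
Proof.
by apply/permP => u; rewrite -(idx2_half u) permM !block_permE permM.
Qed.

Lemma block_perm_tperm i j : block_perm (tperm i j) =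
  (tperm (idx2 i false) (idx2 j false) * tperm (idx2 i true) (idx2 j true))%g.
Proof.
apply/permP => u; rewrite -(idx2_half u) permM block_permE.
move: (half_ord u) (odd u) => k [].
  rewrite (@tpermD _ (idx2 i false)) ?eq_idx2 ?andbF //.
  case: (tpermP i j k) => [->|->|/eqP ki /eqP kj]; rewrite ?tpermL ?tpermR //.
  by rewrite tpermD // eq_idx2 andbT eq_sym.
case: (tpermP i j k) => [->|->|/eqP ki /eqP kj]; rewrite ?tpermL ?tpermR.
- by rewrite tpermD // eq_idx2 andbF.
- by rewrite tpermD // eq_idx2 andbF.
- by rewrite !tpermD // eq_idx2 ?andbF // andbT eq_sym.
Qed.

(** A transposition of blocks is a product of two transpositions; this makes the Pfaffian
    insensitive to the order of the points. *)
Lemma odd_block_perm s : odd_perm (block_perm s) = false.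
Proof.
have [ts -> _] := prod_tpermP s.
elim: ts => [|[i j] ts IHts].
  rewrite big_nil (_ : block_perm 1 = 1%g) ?odd_perm1 //.
  by apply/permP => u; rewrite -(idx2_half u) block_permE !perm1.
rewrite big_cons block_permM odd_permM IHts addbF block_perm_tperm.
by rewrite odd_permM !odd_tperm !eq_idx2 !andbT addbb.
Qed.

End BlockPermutations.

Section Pfaffian.
Variable R : realType.

Definition pf_term n (A : 'I_(n.*2) -> 'I_(n.*2) -> R) (s : 'S_(n.*2)) : R :=
  (-1) ^+ s * \prod_(i < n) A (s (idx2 i false)) (s (idx2 i true)).

Lemma pfaffian_block n (A : 'I_(n.*2) -> 'I_(n.*2) -> R) (t : 'S_n) :
  pfaffian (fun u v => A (block_perm t u) (block_perm t v)) = pfaffian A.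
Proof.
rewrite /pfaffian [in RHS](reindex_inj (mulIg (block_perm t))) /=; congr (_ * _).
apply: eq_bigr => s _; rewrite odd_permM odd_block_perm addbF; congr (_ * _).
by apply: eq_bigr => i _; rewrite !permM.
Qed.

Lemma pf_term_block n (A : 'I_(n.*2) -> 'I_(n.*2) -> R) (t : 'S_n) s :
  pf_term A (block_perm t * s)%g = pf_term A s.
Proof.
rewrite /pf_term odd_permM odd_block_perm; congr (_ * _).
rewrite [in RHS](reindex_inj (@perm_inj _ t)) /=.
by apply: eq_bigr => i _; rewrite !permM !block_permE.
Qed.

Lemma pf_term_flip n (A : 'I_(n.*2) -> 'I_(n.*2) -> R) i s :
  (forall u v, A u v = - A v u) ->
  pf_term A (tperm (idx2 i false) (idx2 i true) * s)%g = pf_term A s.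
Proof.
move=> Aas; rewrite /pf_term odd_permM odd_tperm eq_idx2 andbF /= signrN.
rewrite (bigD1 i) //= [in RHS](bigD1 i) //= !permM tpermL tpermR Aas.
rewrite !mulNr mulrN opprK; congr (_ * (_ * _)).
apply: eq_bigr => j ji; have ij : i == j = false by rewrite eq_sym (negPf ji).
by rewrite !permM !tpermD ?eq_idx2 ?ij ?andbF.
Qed.


(** Block permutations and flips inside a pair leave the terms unchanged, and together they carry
    position 0 to any position k. *)
Lemma sum_pf_term_at n (A : 'I_(n.+1.*2) -> 'I_(n.+1.*2) -> R) k :
  (forall u v, A u v = - A v u) ->
  \sum_(s : 'S_(n.+1.*2) | s k == ord0) pf_term A s =
  \sum_(s : 'S_(n.+1.*2) | s ord0 == ord0) pf_term A s.
Proof.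
move=> Aas.
have [t t0 tA] : exists2 t : 'S_(n.+1.*2), t ord0 = k &
    forall s, pf_term A (t * s)%g = pf_term A s.
  rewrite -(idx2_half k); move: (half_ord k) (odd k) => i b.
  have i0 : ord0 = idx2 ord0 false :> 'I_(n.+1.*2) by exact: val_inj.
  have b0 : block_perm (tperm ord0 i) ord0 = idx2 i false.
    by rewrite i0 block_permE tpermL.
  case: b; last by exists (block_perm (tperm ord0 i)) => // s; exact: pf_term_block.
  exists (block_perm (tperm ord0 i) * tperm (idx2 i false) (idx2 i true))%g.
    by rewrite permM b0 tpermL.
  by move=> s; rewrite -mulgA pf_term_block pf_term_flip.
rewrite [in RHS](reindex_inj (mulgI t)) /=.
by apply: eq_big => s; rewrite ?permM ?t0 ?tA.
Qed.

Lemma lift_perm_bij n (i j : 'I_n.+1) :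
  {on [pred s : 'S_n.+1 | s i == j], bijective (lift_perm i j)}.
Proof.
(* The default k of [odflt] is never reached when s i = j, since s (lift i k) then differs from
   j. *)
pose f (s : 'S_n.+1) (k : 'I_n) : 'I_n := odflt k (unlift j (s (lift i k))).
have fP (s : 'S_n.+1) k : s i = j -> lift j (f s k) = s (lift i k).
  move=> sij; rewrite /f; case: unliftP => //= /eqP.
  by rewrite -sij (inj_eq perm_inj) eq_sym (negPf (neq_lift _ _)).
have f_inj (s : 'S_n.+1) : s i = j -> injective (f s).
  by move=> sij k l /(congr1 (lift j)); rewrite !fP // => /perm_inj/lift_inj.
pose g (s : 'S_n.+1) : 'S_n := if pselect (s i = j) is left sij then perm (f_inj s sij) else 1%g.
exists g => s.
  rewrite inE => _; apply/permP => k; rewrite /g; case: pselect => [e|[]];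
    last by rewrite lift_perm_id.
  by apply: (@lift_inj _ j); rewrite permE fP // lift_perm_lift.
rewrite inE => /eqP sij; apply/permP => k; rewrite /g; case: pselect => // e.
by case: (unliftP i k) => [l|] ->; rewrite ?lift_perm_id // lift_perm_lift permE fP.
Qed.


(** The permutation pairs the head x with entry j of l and s arranges the rest; the two lifts
    contribute the sign (-1)^j. *)
Lemma pf_term_lift (T : eqType) (x0 : T) (A : T -> T -> R) n x (l : seq T)
    (j : 'I_(n.*2).+1) (s : 'S_(n.*2)) : size l = (n.*2).+1 ->
  pf_term (fun u v : 'I_(n.+1.*2) => A (nth x0 (x :: l) u) (nth x0 (x :: l) v))
    (lift_perm ord0 ord0 (lift_perm ord0 j s)) =
  (-1) ^+ j * A x (nth x0 l j) *
  pf_term (fun u v : 'I_(n.*2) => A (nth x0 (take j l ++ drop j.+1 l) u)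
                                    (nth x0 (take j l ++ drop j.+1 l) v)) s.
Proof.
move=> szl; rewrite /pf_term !odd_lift_perm /= signr_addb signr_odd.
rewrite [X in _ * X = _]big_ord_recl /=.
have i0 : idx2 ord0 false = ord0 :> 'I_(n.+1.*2) by exact: val_inj.
have i1 : idx2 ord0 true = lift ord0 ord0 :> 'I_(n.+1.*2) by exact: val_inj.
rewrite i0 i1 lift_perm_lift !lift_perm_id /= -[RHS]mulrA -[LHS]mulrA; congr (_ * _).
rewrite [LHS]mulrCA; congr (_ * (_ * _)).
have nthl (u : 'I_(n.*2)) : nth x0 l (lift j u) = nth x0 (take j l ++ drop j.+1 l) u.
  have jl : (j <= size l)%N by rewrite szl ltnW.
  rewrite nth_cat size_takel // /= /bump; case: ltnP => uj.
    by rewrite add0n nth_take.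
  by rewrite add1n nth_drop addSn subnKC.
apply: eq_bigr => i _.
have iS b : idx2 (lift ord0 i) b = lift ord0 (lift ord0 (idx2 i b)) :> 'I_(n.+1.*2).
  by apply: val_inj; rewrite /= /bump /= !add1n doubleS.
have nthS (k : 'I_(n.*2).+1) : nth x0 (x :: l) (lift ord0 k) = nth x0 l k by [].
by rewrite !iS !lift_perm_lift !nthS !nthl.
Qed.

(** The 2(n+1) possible positions of index 0 contribute equally, which turns the normalisation
    2^(n+1) (n+1)! into 2^n n!; with index 0 in front, summing over its partner is the expansion
    along the first row. *)
Lemma pfaffian_pfl (T : eqType) (x0 : T) (A : T -> T -> R) n (l : seq T) :
  (forall x y, A x y = - A y x) -> size l = n.*2 ->
  pfaffian (fun u v : 'I_(n.*2) => A (nth x0 l u) (nth x0 l v)) = pfl A n l.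
Proof.
move=> Aas; elim: n l => [|n IHn] l.
  case: l => // _; rewrite /pfaffian /=.
  rewrite (eq_bigr (fun=> 1)) => [|s _]; last first.
    by rewrite big_ord0 mulr1 (_ : s = 1%g) ?odd_perm1 //; apply/permP => -[].
  by rewrite sumr_const card_Sn fact0 expn0 mul1n invr1 mul1r.
case: l => // x l [szl].
rewrite /pfaffian; under eq_bigr do rewrite -/(pf_term _ _).
rewrite (partition_big (fun s : 'S_(n.+1.*2) => s^-1%g ord0) predT) //=.
rewrite (eq_bigr (fun k : 'I_(n.+1.*2) => \sum_(s : 'S_(n.+1.*2) | s ord0 == ord0)
   pf_term (fun u v => A (nth x0 (x :: l) u) (nth x0 (x :: l) v)) s)); last first.
  move=> k _; rewrite -(@sum_pf_term_at _ _ k); last by move=> u v; exact: Aas.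
  by apply: eq_bigl => s; rewrite (canF_eq (permKV s)) eq_sym.
rewrite sumr_const card_ord.
rewrite (reindex (lift_perm ord0 ord0)); last exact: lift_perm_bij.
rewrite (eq_bigl predT) => [|s]; last by rewrite lift_perm_id eqxx.
rewrite (partition_big (fun s : 'S_(n.*2).+1 => s ord0) predT) //=.
rewrite (contr_sum x0) szl.
rewrite -[X in _ * X]mulr_natl mulrA mulr_sumr; apply: eq_bigr => j _.
rewrite (reindex (lift_perm ord0 j)); last exact: lift_perm_bij.
rewrite (eq_bigl predT) => [|s]; last by rewrite lift_perm_id eqxx.
under eq_bigr do rewrite pf_term_lift //.
rewrite -mulr_sumr -IHn; last first.
  have jl : (j < size l)%N by rewrite szl.
  by rewrite size_cat size_takel 1?ltnW // size_drop szl subSS subnKC // -ltnS.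
rewrite /pfaffian [LHS]mulrCA; congr (_ * (_ * _)).
have nz m : m.+1%:R != 0 :> R by rewrite pnatr_eq0.
rewrite expnS factS (_ : (2 * 2 ^ n * (n.+1 * n`!))%N = (2 ^ n * n`! * n.+1.*2)%N); last first.
  by rewrite -muln2; lia.
by rewrite natrM invfM -mulrA mulVf ?mulr1 // doubleS.
Qed.

End Pfaffian.

(** * Spins and the generator *)

Section Spin.
Variables (R : realType) (theta : R).
Implicit Types (x y z a b : int) (e : config) (s : seq int).
Local Notation sigma := (sigma theta).

Lemma sigma_prod y m e :
  sigma y (y + m%:Z) e = \prod_(k < m) (- theta) ^+ e (y + k%:Z).
Proof.
rewrite /Defs.sigma /cnt addrAC subrr add0r max_r // absz_nat big_mkord.
by rewrite expr_sum.
Qed.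

Lemma le_exp_nat y z : y <= z -> exists m : nat, z = y + m%:Z.
Proof. by move=> yz; exists `|z - y|%N; lia. Qed.

Lemma sigma_id y e : sigma y y e = 1.
Proof. by have := sigma_prod y 0 e; rewrite addr0 big_ord0. Qed.

Lemma sigma_cat y x z e : y <= x -> x <= z ->
  sigma y z e = sigma y x e * sigma x z e.
Proof.
move=> /le_exp_nat[m ->] /le_exp_nat[k ->].
rewrite -[in LHS]addrA -PoszD !sigma_prod big_split_ord /=; congr (_ * _).
apply: eq_bigr => i _.
by rewrite PoszD addrA.
Qed.

Lemma sigma1 y e : sigma y (y + 1) e = (- theta) ^+ e y.
Proof. by have := sigma_prod y 1 e; rewrite big_ord1 addr0. Qed.

Lemma sigma1_pred y e : sigma (y - 1) y e = (- theta) ^+ e (y - 1).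
Proof. by rewrite -sigma1 subrK. Qed.

Lemma eq_sigma y z e1 e2 : y <= z ->
  (forall x, y <= x -> x < z -> e1 x = e2 x) -> sigma y z e1 = sigma y z e2.
Proof.
move=> /le_exp_nat[m ->] e12; rewrite !sigma_prod.
by apply: eq_bigr => i _; rewrite e12 //; have := ltn_ord i; lia.
Qed.

Fixpoint prod_sigma s e : R :=
  if s is a :: b :: s' then sigma a b e * prod_sigma s' e else 1.

Lemma eq_prod_sigma a s e1 e2 : sorted <=%R s -> all (>= a) s ->
  (forall x, a <= x -> e1 x = e2 x) -> prod_sigma s e1 = prod_sigma s e2.
Proof.
move=> + + e12; have [m] := ubnP (size s); elim: m s => // m IHm [|b [|c s]] //= sm.
move=> /andP[bc cs] /and3P[ab ac ls].
rewrite (IHm s) ?(path_sorted cs) //; last by lia.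
congr (_ * _); apply: eq_sigma => // x bx _; apply: e12; exact: le_trans bx.
Qed.

Lemma upd_a_src x y e : x != y -> upd_a x y e x = false.
Proof. by rewrite /upd_a eqxx => /negPf ->. Qed.
Lemma upd_c_src x y e : x != y -> upd_c x y e x = false.
Proof. by rewrite /upd_c eqxx => /negPf ->. Qed.
Lemma upd_a_dst x y e : upd_a x y e y = addb (e x) (e y).
Proof. by rewrite /upd_a eqxx. Qed.
Lemma upd_c_dst x y e : upd_c x y e y = (e x || e y).
Proof. by rewrite /upd_c eqxx. Qed.
Lemma upd_a_off x y e z : z != x -> z != y -> upd_a x y e z = e z.
Proof. by rewrite /upd_a => /negPf -> /negPf ->. Qed.
Lemma upd_c_off x y e z : z != x -> z != y -> upd_c x y e z = e z.
Proof. by rewrite /upd_c => /negPf -> /negPf ->. Qed.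

Variables p q : int -> R.

Definition jump x (F : config -> R) e : R :=
  q x * (theta * F (upd_a x (x - 1) e) + (1 - theta) * F (upd_c x (x - 1) e)
         - F e)
  + p x * (theta * F (upd_a (x - 1) x e) + (1 - theta) * F (upd_c (x - 1) x e)
         - F e).

Definition frozen x (F : config -> R) e :=
  forall e', (forall z, z != x -> z != x - 1 -> e' z = e z) -> F e' = F e.

Lemma jumpM x F G e : frozen x F e ->
  jump x (fun e => F e * G e) e = F e * jump x G e.
Proof.
move=> Fe; rewrite /jump !Fe ; try by move=> *; rewrite ?upd_a_off ?upd_c_off.
by ring.
Qed.

Lemma jump_frozen x F e : frozen x F e -> jump x F e = 0.
Proof.
move=> Fe; rewrite /jump !Fe ; try by move=> *; rewrite ?upd_a_off ?upd_c_off.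
by ring.
Qed.

(** A bond with both sites outside [a, b) changes nothing; with both inside, the spin is conserved
    in mean because theta + (1 - theta)(-theta) = (-theta)^2. At an endpoint, a jump out of the
    interval erases the spin of the inner site and a jump into it multiplies in, in mean, the spin
    of the outer site: the endpoint moves by one. *)
Lemma jump_sigma x a b e : a < b ->
  jump x (sigma a b) e =
    (x == a)%:R * site_gen p q (fun y => sigma y b e) a +
    (x == b)%:R * site_gen p q (fun z => sigma a z e) b.
Proof.
move=> ab.
have [xlo|] := boolP ((x < a) || (b < x)).
  have fr : frozen x (sigma a b) e.
    move=> e' ee; apply: eq_sigma; first exact: ltW.
    by move=> z az zb; apply: ee; lia.
  have [-> ->] : (x == a) = false /\ (x == b) = false by lia.
  by rewrite jump_frozen // !mul0r addr0.
rewrite negb_or -!leNgt => /andP[ax xb].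
have xx : x != x - 1 by lia.
have xx' : x - 1 != x by lia.
have [xa|xa] := eqVneq x a.
  subst a; have -> : (x == b) = false by lia.
  have off e' : (forall z, z != x -> z != x - 1 -> e' z = e z) ->
      sigma x b e' = (- theta) ^+ e' x * sigma (x + 1) b e.
    move=> ee; rewrite (@sigma_cat x (x + 1)) ?sigma1; try lia.
    by congr (_ * _); apply: eq_sigma => [|z xz zb]; [lia|apply: ee; lia].
  rewrite /jump /site_gen (@sigma_cat (x - 1) x b e) ?sigma1_pred; try lia.
  rewrite !off; try by move=> *; rewrite ?upd_a_off ?upd_c_off.
  rewrite !upd_a_src // !upd_c_src // !upd_a_dst !upd_c_dst.
  by case: (e x) (e (x - 1)) => [] [] /=; rewrite ?expr0 ?expr1; ring.
have [xb'|xb'] := eqVneq x b.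
  subst b.
  have off e' : (forall z, z != x -> z != x - 1 -> e' z = e z) ->
      sigma a x e' = sigma a (x - 1) e * (- theta) ^+ e' (x - 1).
    move=> ee; rewrite (@sigma_cat a (x - 1)); try lia.
    rewrite sigma1_pred; congr (_ * _).
    by apply: eq_sigma => [|z xz zb]; [lia|apply: ee; lia].
  rewrite /jump /site_gen (@sigma_cat a x (x + 1) e) ?sigma1; try lia.
  rewrite !off; try by move=> *; rewrite ?upd_a_off ?upd_c_off.
  rewrite !upd_a_src // !upd_c_src // !upd_a_dst !upd_c_dst.
  by case: (e x) (e (x - 1)) => [] [] /=; rewrite ?expr0 ?expr1; ring.
have off e' : (forall z, z != x -> z != x - 1 -> e' z = e z) ->
    sigma a b e' = sigma a (x - 1) e * ((- theta) ^+ e' (x - 1) *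
                   ((- theta) ^+ e' x * sigma (x + 1) b e)).
  move=> ee; rewrite (@sigma_cat a (x - 1)); try lia.
  rewrite (@sigma_cat (x - 1) x); try lia.
  rewrite (@sigma_cat x (x + 1)) ?sigma1; try lia.
  rewrite sigma1_pred; congr (_ * (_ * (_ * _))).
    by apply: eq_sigma => [|z xz zb]; [lia|apply: ee; lia].
  by apply: eq_sigma => [|z xz zb]; [lia|apply: ee; lia].
rewrite /jump !off; try by move=> *; rewrite ?upd_a_off ?upd_c_off.
rewrite !upd_a_src // !upd_c_src // !upd_a_dst !upd_c_dst.
by case: (e x) (e (x - 1)) => [] [] /=; rewrite ?expr0 ?expr1; ring.
Qed.

(* Rates supported at the bond x, so that the x-th summand of the particle
   generator is again of the form [lgen]. *)
Definition rate_at x (r : int -> R) y : R := (x == y)%:R * r y.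

Lemma site_gen_at x f y :
  site_gen (rate_at x p) (rate_at x q) f y = (x == y)%:R * site_gen p q f y.
Proof. by rewrite /site_gen /rate_at; ring. Qed.

Lemma lgen_at_out x F s : x \notin s -> lgen (rate_at x p) (rate_at x q) F s = 0.
Proof.
elim: s F => //= y s IHs F; rewrite inE negb_or => /andP[/negPf xy xs].
by rewrite site_gen_at xy mul0r add0r IHs.
Qed.

(** Either b < x and the first interval is frozen, or x <= b and the later intervals, which start
    after b, are. *)
Lemma jump_prod_sigma x s e m : size s = m.*2 -> sorted <%R s ->
  jump x (prod_sigma s) e =
  lgen (rate_at x p) (rate_at x q) (prod_sigma^~ e) s.
Proof.
elim: m s => [|m IHm] [|a [|b s]] //=.
  by move=> _ _; rewrite jump_frozen.
move=> [szs] /andP[ab bs]; have ss := path_sorted bs.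
have bs' := order_path_min lt_trans bs.
have sle : sorted <=%R s by apply: sub_sorted ss => ? ?; exact: ltW.
rewrite (lgenZ _ _ (sigma a b e)) -IHm // !site_gen_at addrA.
have -> : (x == a)%:R * site_gen p q (fun y => sigma y b e * prod_sigma s e) a
    + (x == b)%:R * site_gen p q (fun y => sigma a y e * prod_sigma s e) b
  = prod_sigma s e * jump x (sigma a b) e.
  by rewrite jump_sigma // /site_gen; ring.
have [xb|xb] := leP x b.
  have -> : jump x (fun e => sigma a b e * prod_sigma s e) e =
      prod_sigma s e * jump x (sigma a b) e.
    rewrite -jumpM; last first.
      move=> e' ee; apply: (@eq_prod_sigma (b + 1)) => // [|z bz].
        by apply: sub_all bs' => z /=; lia.
      by apply: ee; lia.
    by rewrite /jump; ring.
  rewrite IHm // lgen_at_out ?mulr0 ?addr0 //.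
  by apply: contraL xb => /(allP bs'); rewrite -ltNge.
rewrite jumpM; last first.
  move=> e' ee; apply: eq_sigma; first exact: ltW.
  by move=> z az zb; apply: ee; lia.
rewrite jump_sigma //; have [-> ->] : (x == a) = false /\ (x == b) = false by lia.
by rewrite !mul0r addr0 mulr0 add0r.
Qed.

(** Each endpoint in [-N, N] is met by exactly one of the bonds k - N, which run from -N to N +
    1. *)
Lemma sum_lgen_at N F s : all (fun y => - N%:Z <= y <= N%:Z) s ->
  \sum_(k < (N.*2).+2)
    lgen (rate_at (k%:Z - N%:Z) p) (rate_at (k%:Z - N%:Z) q) F s = lgen p q F s.
Proof.
elim: s F => [|y s IHs] F /=; first by rewrite big1.
move=> /andP[yN sN]; rewrite big_split /= IHs //; congr (_ + _).
have kN : (`|(y + N%:Z)%R|%N < (N.*2).+2)%N by lia.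
rewrite (bigD1 (Ordinal kN)) //= big1 => [|k kk]; rewrite site_gen_at.
  have -> : ((`|(y + N%:Z)%R|%N)%:Z - N%:Z == y) by lia.
  by rewrite mul1r addr0.
have -> : (k%:Z - N%:Z == y) = false; last by rewrite mul0r.
by apply: contraNF kk => /eqP yk; apply/eqP/val_inj => /=; lia.
Qed.

Lemma gen_prod_sigma N s e m : size s = m.*2 -> sorted <%R s ->
  all (fun y => - N%:Z <= y <= N%:Z) s ->
  gen theta p q N (prod_sigma s) e = lgen p q (prod_sigma^~ e) s.
Proof.
move=> szs ss sN; rewrite -(sum_lgen_at _ sN).
by apply: eq_bigr => k _; rewrite -(jump_prod_sigma _ _ szs ss).
Qed.

(** An aligned pair is an empty interval with spin 1; a straddling pair joins two adjacent intervals
    by [sigma_cat]. *)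
Lemma prod_sigma_cat_pair y s1 s2 e m : size (s1 ++ s2) = m.*2 ->
  sorted <=%R (s1 ++ [:: y, y & s2]) ->
  prod_sigma (s1 ++ [:: y, y & s2]) e = prod_sigma (s1 ++ s2) e.
Proof.
elim: m s1 s2 => [|m IHm] [|a [|b s1]] s2 //=.
- by move=> /size0nil -> _; rewrite sigma_id mulr1.
- by move=> _ _; rewrite sigma_id mul1r.
- case: s2 => //= z s2 _ /and4P[ay _ yz _].
  by rewrite mulrA -sigma_cat.
- by move=> [sz] /andP[_ /path_sorted ss]; rewrite IHm.
Qed.

End Spin.

(** * Uniqueness for the endpoint equation *)

Section Calculus.
Variable R : realType.

Lemma is_derive_contr (T : eqType) (f : R -> T -> R) (f' : T -> R)
    (g : R -> seq T -> R) (g' : seq T -> R) (t : R) s :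
  {in s, forall y, is_derive t (1 : R) (fun r => f r y) (f' y)} ->
  (forall l, subseq l s -> is_derive t (1 : R) (fun r => g r l) (g' l)) ->
  is_derive t (1 : R) (fun r => contr (f r) (g r) s)
    (contr f' (g t) s + contr (f t) g' s).
Proof.
elim: s g g' => [|x s IHs] g g' df dg.
  by rewrite /= addr0; exact: is_derive_cst.
have dfx := df x (mem_head _ _).
have dgs := dg s (subseq_cons _ _).
have IH : is_derive t (1 : R) (fun r => contr (f r) (fun l => g r (x :: l)) s)
    (contr f' (fun l => g t (x :: l)) s + contr (f t) (fun l => g' (x :: l)) s).
  apply: (IHs (fun r l => g r (x :: l))) => [y ys|l ls].
    by apply: df; rewrite inE ys orbT.
  by apply: dg; rewrite /= eqxx.
refine (is_derive_eq (is_deriveB (is_deriveM dfx dgs) IH) _).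
by rewrite /GRing.scale /=; ring.
Qed.

Lemma is_derive_pfl (T : eqType) (K : R -> T -> T -> R) K' (t : R) n s :
  pairwise (fun x y => `[< is_derive t (1 : R) (fun r => K r x y) (K' x y) >]) s ->
  is_derive t (1 : R) (fun r => pfl (K r) n s) (dpfl (K t) K' n s).
Proof.
elim: n s => [|n IHn] [|x s] /=; try by move=> _; exact: is_derive_cst.
move=> /andP[/allP Kx Ks]; apply: is_derive_contr => [y /Kx /asboolP//|l ls].
exact/IHn/(subseq_pairwise ls).
Qed.

Lemma cvg_contr (T : eqType) (F : set_system R) {FF : Filter F}
    (f : R -> T -> R) (f0 : T -> R) (g : R -> seq T -> R) (g0 : seq T -> R) s :
  (forall y, f r y @[r --> F] --> f0 y) ->
  (forall l, g r l @[r --> F] --> g0 l) ->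
  contr (f r) (g r) s @[r --> F] --> contr f0 g0 s.
Proof.
move=> cf; elim: s g g0 => [|x s IHs] g g0 cg; first exact: cvg_cst.
by apply: cvgB; [exact: cvgM|apply: (IHs (fun r l => g r (x :: l)))].
Qed.

Lemma cvg_pfl (T : eqType) (F : set_system R) {FF : Filter F}
    (K : R -> T -> T -> R) (K0 : T -> T -> R) n s :
  (forall x y, K r x y @[r --> F] --> K0 x y) ->
  pfl (K r) n s @[r --> F] --> pfl K0 n s.
Proof.
move=> cK; elim: n s => [|n IHn] [|x s]; try exact: cvg_cst.
exact: cvg_contr.
Qed.

(* One Picard step: exp_coeff (C * s) k.+1 = (C s)^(k+1) / (k+1)! is the
   integral of C * exp_coeff (C * s) k. *)
Lemma le_exp_coeff_of_derive (f df : R -> R) (B C : R) k (t : R) :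
  (forall s : R, 0 < s -> is_derive s (1 : R) f (df s)) ->
  f s @[s --> (0:R)^'+] --> (0 : R) -> f 0 = 0 ->
  (forall s : R, 0 < s -> df s <= C * (B * exp_coeff (C * s) k)) ->
  0 <= t -> f t <= B * exp_coeff (C * t) k.+1.
Proof.
move=> f' fr0 f0 dfle; rewrite le_eqVlt => /predU1P[<-|t0].
  by rewrite f0 mulr0 /exp_coeff /= expr0n /= mul0r mulr0.
pose A := B * C ^+ k.+1 / k.+1`!%:R.
have AE s : B * exp_coeff (C * s) k.+1 = A * s ^+ k.+1.
  by rewrite /exp_coeff /= exprMn /A; ring.
pose h (s : R) : R := A * s ^+ k.+1.
have dh (s : R) : is_derive s (1 : R) h (A * (k.+1%:R * s ^+ k)).
  have := is_deriveZ A (is_deriveX k.+1 (is_derive_id s (1 : R))).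
  by rewrite exprfctE => /is_derive_eq; apply; rewrite /GRing.scale /= mulr1.
have ch (s : R) : h r @[r --> s] --> h s.
  by apply/differentiable_continuous/derivable1_diffP; have [] := dh s.
have cf (s : R) : 0 < s -> f r @[r --> s] --> f s.
  by move=> /f' [fs _]; apply/differentiable_continuous/derivable1_diffP.
pose g (s : R) : R := h s - f s.
have dg (s : R) : 0 < s -> is_derive s (1 : R) g (A * (k.+1%:R * s ^+ k) - df s).
  by move=> s0; exact: is_deriveB (dh s) (f' _ s0).
(* f is differentiable at positive times only, so continuity at 0 comes from the right limit. *)
have gcont : {within `[0, t], continuous g}.
  apply/continuous_within_itvP => //; split.
  - move=> s /[!in_itv]/= /andP[s0 _]; apply: cvgB; [exact: ch|exact: cf].
  - apply: cvgB; first exact/cvg_at_right_filter/ch.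
    by rewrite f0.
  - apply: cvgB; first exact/cvg_at_left_filter/ch.
    exact/cvg_at_left_filter/cf.
have dg_in (s : R) : s \in `]0, t[%R ->
    is_derive s (1 : R) g (A * (k.+1%:R * s ^+ k) - df s).
  by rewrite in_itv /= => /andP[/dg].
have [c] := MVT t0 dg_in gcont.
rewrite in_itv /= => /andP[c0 ct] e.
have g0 : g 0 = 0 by rewrite /g /h f0 expr0n /= mulr0 subr0.
rewrite g0 !subr0 in e.
rewrite AE -subr_ge0 -[X in _ <= X]/(g t) e mulr_ge0 // ?(ltW t0) //.
rewrite subr_ge0 (le_trans (dfle _ c0)) // /A /exp_coeff /= factS exprMn natrM invfM exprS.
rewrite le_eqVlt; apply/orP; left; apply/eqP.
have : k.+1%:R != 0 :> R by rewrite pnatr_eq0.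
have : k`!%:R != 0 :> R by rewrite pnatr_eq0 -lt0n fact_gt0.
by move: k.+1%:R k`!%:R => u v u0 v0; field; rewrite u0 v0.
Qed.

Lemma norm_le_exp_coeff_of_derive (f df : R -> R) (B C : R) k (t : R) :
  (forall s : R, 0 < s -> is_derive s (1 : R) f (df s)) ->
  f s @[s --> (0:R)^'+] --> (0 : R) -> f 0 = 0 ->
  (forall s : R, 0 < s -> `|df s| <= C * (B * exp_coeff (C * s) k)) ->
  0 <= t -> `|f t| <= B * exp_coeff (C * t) k.+1.
Proof.
move=> f' fr0 f0 dfle t0; rewrite ler_norml lerNl; apply/andP; split; last first.
  apply: (le_exp_coeff_of_derive f') => // s s0.
  exact: le_trans (ler_norm _) (dfle _ s0).
apply: (@le_exp_coeff_of_derive (fun s => - f s) (fun s => - df s)) => //.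
- by move=> s /f'; exact: is_deriveN.
- by rewrite -[X in _ --> X]oppr0; exact: cvgN.
- by rewrite f0 oppr0.
- by move=> s s0; apply: le_trans (dfle _ s0); rewrite -normrN ler_norm.
Qed.

End Calculus.

Section Uniqueness.
Variables (R : realType) (p q : int -> R) (M : R).
Hypotheses (p0 : forall x, 0 <= p x) (q0 : forall x, 0 <= q x).
Hypotheses (pM : forall x, p x <= M) (qM : forall x, q x <= M).

(** The lists other than s that enter the value of [lgen] at s. *)
Fixpoint neighbours (s : seq int) : seq (seq int) :=
  if s is x :: s' then
    [:: (x + 1) :: s', (x - 1) :: s' & map (cons x) (neighbours s')]
  else [::].

Lemma size_neighbours s l : l \in neighbours s -> size l = size s.
Proof.
elim: s l => //= x s IHs l; rewrite !inE => /or3P[/eqP->|/eqP->|]//.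
by move=> /mapP[k /IHs sk ->] /=; rewrite sk.
Qed.

(** A unit step of one entry of a strictly increasing integer list can at worst make two adjacent
    entries equal. *)
Lemma sorted_neighbours s l : sorted <%R s -> l \in neighbours s ->
  sorted <=%R l.
Proof.
case: s => //= x s; rewrite !inE => xs.
have sub_le (y : int) k : path <%R y k -> path <=%R y k.
  by apply: sub_path => ? ?; exact: ltW.
have up (y : int) k : path <%R y k -> path <=%R (y + 1) k.
  by case: k => //= z k /andP[yz /sub_le ->]; rewrite andbT; lia.
have down (y : int) k : path <%R y k -> path <=%R (y - 1) k.
  by case: k => //= z k /andP[yz /sub_le ->]; rewrite andbT; lia.
move=> /or3P[/eqP->|/eqP->|/mapP[k + ->]] /=; rewrite ?up ?down//.
elim: s x k xs => //= y s IHs x k /andP[xy ys].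
rewrite !inE => /or3P[/eqP->|/eqP->|/mapP[j js ->]] /=.
- by rewrite up // andbT; lia.
- by rewrite down // andbT; lia.
- by rewrite (IHs y) // ltW.
Qed.

(** Each entry carries two rates bounded by M, each times a difference bounded by 2 b. *)
Lemma norm_lgen_le F s b : `|F s| <= b -> {in neighbours s, forall l, `|F l| <= b} ->
  `|lgen p q F s| <= (size s)%:R * (4 * M) * b.
Proof.
elim: s F => [|x s IHs] F Fs Fn /=; first by rewrite normr0 !mul0r.
have IH := IHs (fun l => F (x :: l)) Fs.
rewrite -natr1 mulrDl mul1r mulrDl addrC (le_trans (ler_normD _ _)) // lerD //.
  by apply: IH => l ls; rewrite Fn // !inE map_f ?orbT.
have Fu : `|F ((x + 1) :: s)| <= b by rewrite Fn // !inE eqxx.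
have Fd : `|F ((x - 1) :: s)| <= b by rewrite Fn // !inE eqxx orbT.
have b0 : 0 <= b by exact: le_trans (normr_ge0 _) Fs.
have step (r : R) u : 0 <= r -> r <= M -> `|u| <= b -> `|r * (u - F (x :: s))| <= M * (b + b).
  move=> r0 rM ub; rewrite normrM ger0_norm // ler_pM //.
  exact: le_trans (ler_normB _ _) (lerD ub Fs).
apply: le_trans (ler_normD _ _) _.
apply: le_trans (lerD (step _ _ (q0 x) (qM x) Fu) (step _ _ (p0 x) (pM x) Fd)) _.
by rewrite le_eqVlt; apply/orP; left; apply/eqP; ring.
Qed.

(** The bound B improves to B (C t)^k / k! for every k, which tends to 0. The iteration closes
    because the equation at a strictly increasing list involves only weakly increasing ones, and V
    vanishes on those with a repeated entry. *)
Lemma lgen_uniqueness (V : R -> seq int -> R) (m : nat) (B : R) :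
  (forall (t : R) s, 0 < t -> size s = m -> sorted <%R s ->
     is_derive t (1 : R) (fun r => V r s) (lgen p q (V t) s)) ->
  (forall s, size s = m -> sorted <%R s -> V r s @[r --> (0 : R)^'+] --> (0 : R)) ->
  (forall s, size s = m -> sorted <%R s -> V 0 s = 0) ->
  (forall (t : R) s, 0 <= t -> size s = m -> sorted <=%R s -> ~~ sorted <%R s -> V t s = 0) ->
  (forall (t : R) s, 0 <= t -> size s = m -> sorted <=%R s -> `|V t s| <= B) ->
  forall (t : R) s, 0 <= t -> size s = m -> sorted <=%R s -> V t s = 0.
Proof.
move=> V' V0c V0 Vbd VB.
pose C := m%:R * (4 * M).
have C0 : 0 <= C by rewrite !mulr_ge0 // (le_trans (p0 0)).
have main k t s : 0 <= t -> size s = m -> sorted <=%R s ->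
    `|V t s| <= B * exp_coeff (C * t) k.
  elim: k t s => [|k IHk] t s t0 szs ss.
    by rewrite /exp_coeff /= expr0 fact0 divr1 mulr1; exact: VB.
  have [lts|nlts] := boolP (sorted <%R s); last first.
    rewrite (Vbd t s) // normr0 mulr_ge0 ?exp_coeff_ge0 ?(mulr_ge0 C0) //.
    exact: le_trans (normr_ge0 _) (VB t s t0 szs ss).
  apply: (@norm_le_exp_coeff_of_derive _ (fun r => V r s) (fun r => lgen p q (V r) s)) => //.
  - by move=> r r0; exact: V'.
  - exact: V0c.
  - exact: V0.
  move=> r /ltW r0; rewrite {1}/C -szs; apply: norm_lgen_le; first exact: IHk.
  move=> l ls; apply: IHk => //; first by rewrite (size_neighbours ls).
  exact: sorted_neighbours ls.
move=> t s t0 szs ss; apply/eqP; rewrite -normr_le0.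
have cvg0 : B * exp_coeff (C * t) k @[k --> \oo] --> (0 : R).
  by rewrite -(mulr0 B); apply: cvgM; [exact: cvg_cst|exact: cvg_exp_coeff].
rewrite -(cvg_lim _ cvg0) //; apply: limr_ge; first by apply/cvg_ex; exists 0.
by near=> k; exact: main.
Unshelve. all: by end_near.
Qed.

Lemma sorted_le_pair (s : seq int) : sorted <=%R s -> ~~ sorted <%R s ->
  exists y s1 s2, s = s1 ++ [:: y, y & s2].
Proof.
elim: s => // x [|y s] IHs //= /andP[]; rewrite le_eqVlt => /predU1P[<-|xy] ys.
  by move=> _; exists x, [::], s.
rewrite xy /= => /(IHs ys)[z [s1 [s2 ->]]].
by exists z, (x :: s1), s2.
Qed.

End Uniqueness.

Section ListBounds.
Variables (R : realType) (T : eqType).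

Lemma norm_contr_le (f : T -> R) g s c : (forall y, `|f y| <= 1) ->
  (forall l, (size l <= size s)%N -> `|g l| <= c) ->
  `|contr f g s| <= (size s)%:R * c.
Proof.
move=> f1; elim: s g => [|x s IHs] g gc; first by rewrite /= normr0 mul0r.
rewrite [size _]/= -natr1 mulrDl mul1r /= [leRHS]addrC (le_trans (ler_normB _ _)) // lerD //.
  by rewrite normrM -[c]mul1r ler_pM // gc /=.
by apply: IHs => l ls; exact: gc.
Qed.

(** Each of the n expansions has at most b terms; uniqueness needs only a bound uniform in time. *)
Lemma norm_pfl_le (K : T -> T -> R) n s b : (forall x y, `|K x y| <= 1) ->
  (size s <= b)%N -> `|pfl K n s| <= b%:R ^+ n.
Proof.
move=> K1; elim: n s => [|n IHn] s sb /=.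
  by case: eqP => _; rewrite ?normr1 ?normr0 ?expr0.
case: s sb => [|x s] sb; first by rewrite normr0 exprn_ge0.
have IH l : (size l <= size s)%N -> `|pfl K n l| <= b%:R ^+ n.
  by move=> ls; apply: IHn; rewrite (leq_trans ls) // ltnW.
apply: le_trans (norm_contr_le (K1 x) IH) _.
by rewrite exprS ler_wpM2r ?exprn_ge0 // ler_nat ltnW.
Qed.

End ListBounds.

Section Cylinder.
Variables (R : realType) (theta : R).

Lemma cylinder_cst (c : R) : cylinder (fun=> c).
Proof. by exists 0%N. Qed.

Lemma cylinder_lin (F G : config -> R) a b : cylinder F -> cylinder G ->
  cylinder (fun e => a * F e + b * G e).
Proof.
move=> [N FN] [N' GN]; exists (maxn N N') => e1 e2 e12.
by rewrite (FN e1 e2) ?(GN e1 e2) // => x xN; apply: e12; lia.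
Qed.

Lemma cylinderB (F G : config -> R) : cylinder F -> cylinder G ->
  cylinder (fun e => F e - G e).
Proof.
move=> cF cG; have := cylinder_lin 1 (-1) cF cG; congr cylinder.
by apply/funext => e; rewrite mul1r mulN1r.
Qed.

Lemma ex_bound (s : seq int) : exists N : nat, all (fun y : int => - N%:Z <= y <= N%:Z) s.
Proof.
elim: s => [|x s [N sN]]; first by exists 0%N.
exists (maxn `|x|%N N) => /=; apply/andP; split; first by lia.
by apply: sub_all sN => y; lia.
Qed.

Lemma prod_sigma_within N (s : seq int) : all (fun y : int => - N%:Z <= y <= N%:Z) s ->
  depends_within N (prod_sigma theta s).
Proof.
move=> + e1 e2 e12; have [m] := ubnP (size s); elim: m s => // m IHm [|a [|b s]] //= sm.
move=> /and3P[aN bN sN]; rewrite (IHm s) //; last by lia.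
congr (_ * _); have [ab|ab] := leP a b.
  by apply: eq_sigma => // x ax xb; apply: e12; lia.
(* For b < a the [Num.max] in [cnt] makes the sum empty, so the spin is constant. *)
rewrite /sigma /cnt max_l; last by lia.
by rewrite !big_geq.
Qed.

Lemma cylinder_prod_sigma s : cylinder (prod_sigma theta s).
Proof. by have [N sN] := ex_bound s; exists N; exact: prod_sigma_within. Qed.

Lemma prod_sigma2 y z : prod_sigma theta [:: y; z] = sigma theta y z.
Proof. by apply/funext => e; rewrite /= mulr1. Qed.

(** The spin kernel is multiplicative along increasing points, so [pfl_mul_cons] peels off one pair
    at a time. *)
Lemma pfl_sigma m s e : size s = m.*2 -> sorted <=%R s ->
  pfl (fun y z => sigma theta y z e) m s = prod_sigma theta s e.
Proof.
elim: m s => [|m IHm] [|a [|b s]] // [szs] /= /andP[ab bs].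
rewrite -IHm ?(path_sorted bs) // -[LHS]/(pfl _ m.+1 [:: a, b & s]).
rewrite pfl_mul_cons // => z zs; apply: sigma_cat => //.
exact: (allP (order_path_min le_trans bs)).
Qed.

Lemma norm_prod_sigma_le1 s e : 0 <= theta <= 1 -> `|prod_sigma theta s e| <= 1.
Proof.
move=> theta01; have [m] := ubnP (size s); elim: m s => // m IHm [|a [|b s]] /= sm;
  rewrite ?normr1 //.
rewrite normrM mulr_ile1 ?IHm //; last by lia.
move: theta01 => /andP[t0 t1].
by rewrite /sigma normrX normrN ger0_norm // exprn_ile1.
Qed.

End Cylinder.

(** * Expectations of differences and generators *)

Section LinearFunctional.
Variables (R : realType) (p q : int -> R).
Variable E : R -> (config -> R) -> R.
Hypothesis E_lin : forall t : R, 0 <= t -> forall (F G : config -> R) (a b : R),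
  cylinder F -> cylinder G ->
  E t (fun e => a * F e + b * G e) = a * E t F + b * E t G.

Lemma E_B t (F G : config -> R) : 0 <= t -> cylinder F -> cylinder G ->
  E t (fun e => F e - G e) = E t F - E t G.
Proof.
move=> t0 cF cG; rewrite -[X in X - _]mul1r -mulN1r -E_lin //.
by congr (E t); apply/funext => e; rewrite mul1r mulN1r.
Qed.

Lemma E_Z t a F : 0 <= t -> cylinder F -> E t (fun e => a * F e) = a * E t F.
Proof.
move=> t0 cF; have := E_lin t0 a 0 cF cF; rewrite mul0r addr0 => <-.
by congr (E t); apply/funext => e; rewrite mul0r addr0.
Qed.

(** Both claims share one induction, since linearity of E is available on cylinder functions
    only. *)
Lemma E_ldiff t (Phi : seq int -> config -> R) s : 0 <= t ->
  (forall l, cylinder (Phi l)) ->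
  E t (fun e => ldiff (Phi^~ e) s) = ldiff (fun l => E t (Phi l)) s /\
  cylinder (fun e => ldiff (Phi^~ e) s).
Proof.
move=> t0; elim: s Phi => [|[y a] s IHs] Phi cPhi; first by split; last exact: cPhi.
have [IH cIH] := IHs (fun l => Phi (y :: l)) (fun l => cPhi (y :: l)).
have [IH1 cIH1] := IHs (fun l => Phi (y + 1 :: l)) (fun l => cPhi (y + 1 :: l)).
case: a; last by split.
split; last exact: (cylinderB cIH cIH1).
by rewrite /= /diff_at -IH -IH1 -E_B.
Qed.

Lemma E_lgen t (Phi : seq int -> config -> R) s : 0 <= t ->
  (forall l, cylinder (Phi l)) ->
  E t (fun e => lgen p q (Phi^~ e) s) = lgen p q (fun l => E t (Phi l)) s /\
  cylinder (fun e => lgen p q (Phi^~ e) s).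
Proof.
move=> t0; elim: s Phi => [|x s IHs] Phi cPhi.
  split; last exact: cylinder_cst.
  by have := E_B t0 (cylinder_cst 1) (cylinder_cst 1); rewrite !subrr.
have [IH cIH] := IHs (fun l => Phi (x :: l)) (fun l => cPhi (x :: l)).
have cu := cylinderB (cPhi ((x + 1) :: s)) (cPhi (x :: s)).
have cd := cylinderB (cPhi ((x - 1) :: s)) (cPhi (x :: s)).
have csg := cylinder_lin (q x) (p x) cu cd.
have cc := cylinder_lin 1 1 csg cIH.
have eF : (fun e => lgen p q (Phi^~ e) (x :: s)) = (fun e =>
    1 * (q x * (Phi ((x + 1) :: s) e - Phi (x :: s) e) +
         p x * (Phi ((x - 1) :: s) e - Phi (x :: s) e)) +
    1 * lgen p q (fun l => Phi (x :: l) e) s).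
  by apply/funext => e; rewrite !mul1r.
split; last by rewrite eF.
by rewrite eF (E_lin t0 1 1 csg cIH) IH (E_lin t0 _ _ cu cd) !E_B // !mul1r.
Qed.

End LinearFunctional.

(** * The Pfaffian formula for spin products *)

Section Process.
Variables (R : realType) (theta : R) (p q : int -> R) (eta0 : config).
Variable E : R -> (config -> R) -> R.
Hypothesis theta01 : 0 <= theta <= 1.
Hypotheses (p0 : forall x, 0 <= p x) (q0 : forall x, 0 <= q x).
Variable M : R.
Hypothesis pqM : forall x, p x <= M /\ q x <= M.
Hypothesis E_lin : forall t : R, 0 <= t -> forall (F G : config -> R) (a b : R),
  cylinder F -> cylinder G ->
  E t (fun e => a * F e + b * G e) = a * E t F + b * E t G.
Hypothesis E_pos : forall t : R, 0 <= t -> forall F : config -> R, cylinder F ->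
  (forall e, 0 <= F e) -> 0 <= E t F.
Hypothesis E_1 : forall t : R, 0 <= t -> E t (fun _ => 1) = 1.
Hypothesis E_0 : forall F : config -> R, cylinder F -> E 0 F = F eta0.
Hypothesis E_derive : forall (N : nat) (F : config -> R), depends_within N F ->
  forall t : R, 0 < t ->
    is_derive t (1 : R) (fun s => E s F) (E t (gen theta p q N F)).
Hypothesis E_cvg : forall (N : nat) (F : config -> R), depends_within N F ->
  (fun s => E s F) @ (0 : R)^'+ --> F eta0.

(** Positivity of E on 1 + F and 1 - F. *)
Lemma norm_E_le1 t (F : config -> R) : 0 <= t -> cylinder F ->
  (forall e, `|F e| <= 1) -> `|E t F| <= 1.
Proof.
move=> t0 cF F1; have c1 := @cylinder_cst R 1.
rewrite ler_norml -(E_1 t0); apply/andP; split.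
  rewrite -subr_ge0 opprK.
  have -> : E t F + E t (fun=> 1) = E t (fun e => 1 * F e + 1 * 1).
    by rewrite (E_lin t0 1 1 cF c1) !mul1r.
  apply: E_pos => // [|e]; first exact: (cylinder_lin 1 1 cF c1).
  by have := F1 e; rewrite ler_norml => /andP[]; lra.
rewrite -subr_ge0 -(E_B E_lin) //; apply: E_pos => // [|e]; first exact: cylinderB.
by rewrite subr_ge0 (le_trans (ler_norm _)).
Qed.

Let K t y z := E t (sigma theta y z).

Lemma is_derive_E_prod_sigma (t : R) s m : 0 < t -> size s = m.*2 -> sorted <%R s ->
  is_derive t (1 : R) (fun r => E r (prod_sigma theta s))
    (lgen p q (fun l => E t (prod_sigma theta l)) s).
Proof.
move=> t0 szs ss; have [N sN] := ex_bound s.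
have [<- _] := E_lgen p q E_lin s (ltW t0) (cylinder_prod_sigma theta).
have -> : (fun e => lgen p q ((prod_sigma theta)^~ e) s) =
    gen theta p q N (prod_sigma theta s).
  by apply/funext => e; rewrite (gen_prod_sigma _ _ _ _ szs).
exact/E_derive/t0/prod_sigma_within.
Qed.

(** Uniqueness applies to the difference V of the two sides; the induction on m supplies its
    boundary values at coinciding endpoints. *)
Lemma E_prod_sigma m (s : seq int) (t : R) : 0 <= t -> size s = m.*2 -> sorted <=%R s ->
  E t (prod_sigma theta s) = pfl (K t) m s.
Proof.
elim: m s t => [|m IHm] s t t0; first by move=> /size0nil -> _ /=; exact: E_1.
have cvgK y z : K r y z @[r --> (0 : R)^'+] --> sigma theta y z eta0.
  rewrite /K -prod_sigma2; have [N sN] := ex_bound [:: y; z].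
  exact: (E_cvg (prod_sigma_within theta sN)).
have K0 : K 0 = fun y z => sigma theta y z eta0.
  apply/funext => y; apply/funext => z; rewrite /K -prod_sigma2 E_0 //.
  exact: cylinder_prod_sigma.
pose V (r : R) l := E r (prod_sigma theta l) - pfl (K r) m.+1 l.
move=> szs ss; apply/eqP; rewrite -subr_eq0 -/(V t s); apply/eqP.
(* The bound is 1 for the expectation plus that of [norm_pfl_le] for the Pfaffian. *)
apply: (@lgen_uniqueness R p q M p0 _ _ _ V m.+1.*2 (1 + m.+1.*2%:R ^+ m.+1)) => //.
- by move=> x; have [] := pqM x.
- by move=> x; have [] := pqM x.
- move=> {t0 ss}r l r0 szl sl.
  (* Each entry K r y z is itself the expectation for the two endpoints y and z, so it solves the
     same equation with a single pair. *)
  pose K' y z := site_gen p q ((K r)^~ z) y + site_gen p q (K r y) z.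
  rewrite /V lgenB; apply: is_deriveB; first exact: (is_derive_E_prod_sigma r0 szl sl).
  rewrite -(@dpfl_lgen _ _ _ _ K') //; apply: is_derive_pfl.
  move: sl; rewrite (sorted_pairwise lt_trans); apply: sub_pairwise => y z yz.
  apply/asboolP; rewrite /K -prod_sigma2.
  have syz : sorted <%R [:: y; z] by rewrite /= andbT.
  apply: is_derive_eq (@is_derive_E_prod_sigma r [:: y; z] 1 r0 erefl syz) _.
  by rewrite -[LHS]/(_ + (_ + 0)) addr0 /K' /site_gen /K -!prod_sigma2.
- move=> l szl sl; rewrite -[X in _ --> X](subrr (prod_sigma theta l eta0)); apply: cvgB.
    by have [N lN] := ex_bound l; exact: (E_cvg (prod_sigma_within theta lN)).
  rewrite -(pfl_sigma _ _ szl); last by apply: sub_sorted sl => ? ?; exact: ltW.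
  exact: cvg_pfl.
- move=> l szl sl; rewrite /V E_0 ?K0; last exact: cylinder_prod_sigma.
  by rewrite pfl_sigma ?subrr //; apply: sub_sorted sl => ? ?; exact: ltW.
(* Two equal endpoints drop out of both sides, which leaves the induction hypothesis. *)
- move=> r l r0 szl sl /(sorted_le_pair sl)[y [s1 [s2 el]]].
  subst l; move: szl; rewrite size_cat /= !addnS -size_cat => -[szl].
  rewrite /V.
  have -> : prod_sigma theta (s1 ++ [:: y, y & s2]) = prod_sigma theta (s1 ++ s2).
    by apply/funext => e; rewrite (prod_sigma_cat_pair _ _ szl).
  rewrite pfl_cat_pair => [|z]; last first.
    by rewrite /K (_ : sigma theta z z = fun=> 1) ?E_1 //; apply/funext => e; exact: sigma_id.
  rewrite IHm ?subrr //; apply: (subseq_sorted le_trans _ sl).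
  by rewrite cat_subseq // -[s2]cat0s; exact: (suffix_subseq [:: y; y]).
- move=> r l r0 szl sl; apply: le_trans (ler_normB _ _) _; apply: lerD.
    apply: norm_E_le1 => //; first exact: cylinder_prod_sigma.
    by move=> e; exact: (norm_prod_sigma_le1 _ _ theta01).
  apply: norm_pfl_le; last by rewrite szl.
  move=> y z; rewrite /K -prod_sigma2; apply: norm_E_le1 => //.
    exact: cylinder_prod_sigma.
  by move=> e; exact: (norm_prod_sigma_le1 _ _ theta01).
Qed.

End Process.

(** * Correlation functions *)

Section Points.
Implicit Types (l k : seq int).

(** The two endpoints of the empty interval [z, z), with the difference taken in the second; the
    flag is also the row index in the 2x2 block. *)
Fixpoint points l : seq (int * bool) :=
  if l is z :: l' then [:: (z, false), (z, true) & points l'] else [::].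

Lemma size_points l : size (points l) = (size l).*2.
Proof. by elim: l => //= z l ->. Qed.

Lemma nth_points l i : (i < (size l).*2)%N ->
  nth (0, false) (points l) i = (nth 0 l i./2, odd i).
Proof.
elim: l i => //= z l IHl [|[|i]] //= il.
by rewrite IHl // negbK.
Qed.

Lemma mem_points l u : u \in points l -> u.1 \in l.
Proof.
elim: l => //= z l IHl; rewrite !inE => /or3P[/eqP->|/eqP->|/IHl ->].
- by rewrite eqxx.
- by rewrite eqxx.
- by rewrite orbT.
Qed.

(** A shifted endpoint z + 1 does not pass the next point, so the differences read weakly increasing
    lists only. *)
Lemma sorted_shifted_points l k : sorted <%R l ->
  all2 (fun (z : int) (u : int * bool) => (z == u.1) || u.2 && (z == u.1 + 1))
    k (points l) ->
  size k = (size l).*2 /\ sorted <=%R k.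
Proof.
move=> sl ks; split.
  by move: ks; rewrite all2E => /andP[/eqP ->]; rewrite size_points.
(* Here b is the previous point, whose second endpoint may have moved to b + 1. *)
suff main i : forall (b : int) j, path <%R b i ->
    all2 (fun (z : int) (u : int * bool) => (z == u.1) || u.2 && (z == u.1 + 1))
      j (points i) -> path <=%R (b + 1) j.
  case: l sl ks => [|a l] sl ks; first by case: k ks.
  have pal : path <%R (a - 1) (a :: l) by rewrite /= (sl : path _ _ _) andbT; lia.
  exact: path_sorted (main (a :: l) _ _ pal ks).
elim: i {l k sl ks} => [|a l IHl] b [|z [|w j]] //=.
  by rewrite andbF.
move=> /andP[ba al] /and3P[]; rewrite orbF => /eqP -> {z} wa js.
have := IHl _ _ al js; case: j js => [|v j] js.
  by move=> _; rewrite !andbT; move: wa => /orP[]/eqP->; lia.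
by move=> /= /andP[av ->]; rewrite andbT; move: wa => /orP[]/eqP->; lia.
Qed.

End Points.

Section Kernel.
Variables (R : realType) (theta : R) (K : int -> int -> R).

Definition point_kernel (u v : int * bool) : R :=
  Kbold theta K u.1 v.1 u.2 v.2.

Lemma point_kernel_antisym u v : point_kernel u v = - point_kernel v u.
Proof.
move: u v => [y a] [z b]; rewrite /point_kernel /Kbold /=.
case: (ltgtP y z) => [_|_|->] /=; rewrite ?opprK //.
by case: a b => [] []; rewrite ?oppr0 ?mulNr ?opprK.
Qed.

(** Inside the block of z only the entry with flags false, true is compared; there both sides give K
    z z - K z (z + 1) over 1 + theta. *)
Lemma pairwise_point_kernel l : sorted <%R l ->
  pairwise (fun u v => point_kernel u v == (1 + theta)^-1 * diff_kernel K u v)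
    (points l).
Proof.
have lt_kernel u v : u.1 < v.1 ->
    point_kernel u v = (1 + theta)^-1 * diff_kernel K u v.
  move: u v => [y a] [z b] /= yz; rewrite /point_kernel /Kbold yz /diff_kernel.
  by case: a b => [] []; rewrite /diff_at /=; ring.
elim: l => //= z l IHl zl; rewrite (IHl (path_sorted zl)) andbT.
have gt_z := order_path_min lt_trans zl.
have after a : all (fun v => point_kernel (z, a) v ==
    (1 + theta)^-1 * diff_kernel K (z, a) v) (points l).
  by apply/allP => v /mem_points /(allP gt_z) zv; apply/eqP/lt_kernel.
rewrite !after !andbT /point_kernel /Kbold /diff_kernel /diff_at /= ltxx eqxx.
by apply/eqP; ring.
Qed.

End Kernel.

Section Density.
Variables (R : realType) (theta : R).

Lemma ldiff_prod_sigma l e :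
  ldiff ((prod_sigma theta)^~ e) (points l) =
  (1 + theta) ^+ size l * \prod_(z <- l) (e z : nat)%:R.
Proof.
elim: l => [|z l IHl]; first by rewrite /= big_nil mulr1.
rewrite [LHS]/= /diff_at /= !ldiffZ IHl sigma_id sigma1 big_cons exprS.
by case: (e z); rewrite /= ?expr0 ?expr1; ring.
Qed.


End Density.

Theorem theorem1 (R : realType) (theta : R) (p q : int -> R) (eta0 : config)
  (E : R -> (config -> R) -> R) :
  0 <= theta <= 1 ->
  (forall x, 0 <= p x) -> (forall x, 0 <= q x) ->
  (exists M : R, forall x, p x <= M /\ q x <= M) ->
  (* E t F = E_eta0[F(eta_t)]: for each t >= 0, a normalized positive linear
     functional on cylinder functions (i.e. a probability law on configurations) *)
  (forall t, 0 <= t -> forall (F G : config -> R) (a b : R), cylinder F -> cylinder G ->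
     E t (fun e => a * F e + b * G e) = a * E t F + b * E t G) ->
  (forall t, 0 <= t -> forall F : config -> R, cylinder F ->
     (forall e, 0 <= F e) -> 0 <= E t F) ->
  (forall t, 0 <= t -> E t (fun _ => 1) = 1) ->
  (* initial condition eta_0 = eta0 *)
  (forall F : config -> R, cylinder F -> E 0 F = F eta0) ->
  (* Kolmogorov forward equation d/dt E[F(eta_t)] = E[(L F)(eta_t)] *)
  (forall (N : nat) (F : config -> R), depends_within N F ->
     forall t : R, 0 < t -> is_derive t (1:R) (fun s => E s F) (E t (gen theta p q N F))) ->
  (forall (N : nat) (F : config -> R), depends_within N F ->
     (fun s => E s F) @ (0:R)^'+ --> F eta0) ->
  (* conclusion: eta_t is Pfaffian with the stated kernel *)
  forall t, 0 <= t ->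
  forall (n : nat) (x : nat -> int), (1 <= n)%N ->
  (forall i j, (i < n)%N -> (j < n)%N -> i <> j -> x i <> x j) ->
  E t (fun e => \prod_(i < n) ((e (x i) : nat)%:R : R)) =
  pfaffian (@block_matrix R n
              (Kbold theta (fun y z => E t (sigma theta y z))) x).
Proof.
move=> theta01 p0 q0 [M pqM] E_lin E_pos E_1 E_0 E_derive E_cvg t t0 n x _ x_inj.
set K := fun y z => E t (sigma theta y z).
(* The spin formula needs increasing points, and the correlation is symmetric in them. *)
pose xs := map x (iota 0 n); pose l := sort <=%R xs.
have sz_xs : size xs = n by rewrite size_map size_iota.
have sz_l : size l = n by rewrite size_sort.
have uniq_xs : uniq xs.
  rewrite map_inj_in_uniq ?iota_uniq // => i j; rewrite !mem_iota /= !add0n => iN jN xij.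
  by apply/eqP; apply: contraPT xij => /eqP; exact: x_inj.
have l_sorted : sorted <%R l.
  by rewrite lt_sorted_uniq_le sort_uniq uniq_xs sort_le_sorted.
have -> : (fun e : config => \prod_(i < n) ((e (x i) : nat)%:R : R)) =
    (fun e => (1 + theta)^-1 ^+ n * ldiff ((prod_sigma theta)^~ e) (points l)).
  have th1 : 1 + theta != 0 by move: theta01 => /andP[? ?]; lra.
  apply/funext => e; rewrite ldiff_prod_sigma sz_l mulrA -exprMn mulVf // expr1n mul1r.
  by rewrite (perm_big xs) ?perm_sort // big_map -[in iota 0 n](subn0 n) big_mkord.
have cps := cylinder_prod_sigma theta.
have [E_ld c_ld] := E_ldiff E_lin (points l) t0 cps.
rewrite (E_Z E_lin) // E_ld.
rewrite (@eq_ldiff _ _ (pfl K n)); last first.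
  move=> k /(sorted_shifted_points l_sorted)[]; rewrite sz_l => szk sk.
  exact: (E_prod_sigma theta01 p0 q0 pqM E_lin E_pos E_1 E_0 E_derive E_cvg).
rewrite ldiff_pfl -pflZ -(eq_pfl _ (pairwise_point_kernel theta K l_sorted)).
rewrite -(pfaffian_pfl (0, false) (@point_kernel_antisym _ theta K)); last first.
  by rewrite size_points sz_l.
(* Sorting acts on the matrix as a permutation of 2x2 blocks, which preserves the Pfaffian. *)
have /tuple_permP[s ls] : perm_eq l (Tuple (introT eqP sz_xs)) by rewrite perm_sort.
rewrite -[RHS](pfaffian_block _ s) /block_matrix; congr pfaffian.
have blockE (u : 'I_(n.*2)) :
    ((block_perm s u)./2 = s (half_ord u)) * (odd (block_perm s u) = odd u).
  rewrite -[u in block_perm s u]idx2_half block_permE odd_idx2; split=> //.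
  by rewrite -[LHS]/(val (half_ord _)) half_idx2.
have lx (u : 'I_(n.*2)) : nth 0 l u./2 = x (s (half_ord u)).
  rewrite -[u./2]/(val (half_ord u)) ls nth_mktuple (tnth_nth 0) /=.
  by rewrite (nth_map 0%N) ?size_iota // nth_iota.
apply/funext => u; apply/funext => v.
by rewrite /point_kernel !nth_points ?sz_l //= !lx !blockE.
Qed.
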